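(* Let $\mathcal{K}\subseteq\mathbb{R}^n$ be a proper subdual cone and let $\mathcal{S}=\mathbb{S}^{n-1}\cap\operatorname{int}(\mathcal{K})$. Let $A=A^\top\in\mathbb{R}^{n\times n}$, let $q_A:\mathcal{S}\to\mathbb{R}$, $q_A(x)=\langle Ax,x\rangle$ (extended by the same formula to $\mathbb{S}^{n-1}\cap\mathcal{K}$), and let $\varphi_A(x)=\langle Ax,x\rangle/\|x\|^2$ for $x\neq 0$. The following statements are equivalent: (a) the quadratic function $q_A$ is spherically quasi-convex (on $\mathcal{S}$); (b) $\langle Ax,y\rangle\le\langle x,y\rangle\max\{q_A(x),q_A(y)\}$ for any $x,y\in\mathbb{S}^{n-1}\cap\mathcal{K}$; (c) $\dfrac{\langle Ax,y\rangle}{\langle x,y\rangle}\le\max\{\varphi_A(x),\varphi_A(y)\}$ for any $x,y\in\mathcal{K}$ with $\langle x,y\rangle\neq0$.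
   Context: $\mathbb{S}^{n-1}=\{x\in\mathbb{R}^n:\|x\|=1\}$. A proper cone is a pointed closed convex cone with nonempty interior; $\mathcal{K}^*=\{y:\langle x,y\rangle\ge0\ \forall x\in\mathcal{K}\}$; $\mathcal{K}$ is subdual if $\mathcal{K}\subseteq\mathcal{K}^*$. For $x,y\in\mathbb{S}^{n-1}$ with $y\ne\pm x$ the minimal geodesic from $x$ to $y$ is the constant-speed parametrization $\gamma_{xy}:[0,1]\to\mathbb{S}^{n-1}$ of the shorter great-circle arc from $x$ to $y$: with $d=\arccos\langle x,y\rangle$, $\gamma_{xy}(t)=\bigl(\cos(td)-\tfrac{\langle x,y\rangle\sin(td)}{\sqrt{1-\langle x,y\rangle^2}}\bigr)x+\tfrac{\sin(td)}{\sqrt{1-\langle x,y\rangle^2}}y$. The set $\mathcal{S}$ contains the minimal geodesic between any two of its points (it is spherically convex). A function $f:\mathcal{S}\to\mathbb{R}$ is spherically quasi-convex if for every minimal geodesic segment $\gamma:[0,1]\to\mathcal{S}$ the composition $f\circ\gamma$ is quasi-convex in the usual sense. *)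

(* Defs.v *)
From HB Require Import structures.
From mathcomp Require Import all_boot all_order all_algebra.
From mathcomp Require Import all_classical all_reals.
From mathcomp Require Import topology normedtype trigo convex.
Set Implicit Arguments.
Unset Strict Implicit.
Unset Printing Implicit Defensive.
Import Order.TTheory GRing.Theory Num.Theory.
Import numFieldNormedType.Exports.

Local Open Scope classical_set_scope.
Local Open Scope ring_scope.

(* The library norm on matrices is the sup norm, so the Euclidean inner product
   and norm are introduced here; both norms induce the same topology, hence
   [closed] and [interior] below are the usual ones on R^n. *)
Definition dot (R : realType) (n : nat) (x y : 'cV[R]_n) : R :=
  \sum_(i < n) x i 0 * y i 0.

Definition enorm (R : realType) (n : nat) (x : 'cV[R]_n) : R :=
  Num.sqrt (dot x x).

Definition unit_sphere (R : realType) (n : nat) : set 'cV[R]_n :=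
  [set x | enorm x = 1].
Arguments unit_sphere : clear implicits.

Definition is_cone (R : realType) (n : nat) (K : set 'cV[R]_n) : Prop :=
  forall (x : 'cV[R]_n) (a : R), K x -> 0 < a -> K (a *: x).

Definition pointed_cone (R : realType) (n : nat) (K : set 'cV[R]_n) : Prop :=
  forall x : 'cV[R]_n, K x -> K (- x) -> x = 0.

Definition proper_cone (R : realType) (n : nat) (K : set 'cV[R]_n) : Prop :=
  [/\ is_cone K, convex_set (K : set (convex_lmodType 'cV[R]_n)), closed K,
      pointed_cone K & interior K !=set0].

Definition dual_cone (R : realType) (n : nat) (K : set 'cV[R]_n) :
    set 'cV[R]_n :=
  [set y | forall x, K x -> 0 <= dot x y].

Definition subdual (R : realType) (n : nat) (K : set 'cV[R]_n) : Prop :=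
  K `<=` dual_cone K.

(* Meaningful for unit vectors x and y with y <> x and y <> - x. *)
Definition geodesic (R : realType) (n : nat) (x y : 'cV[R]_n) (t : R) :
    'cV[R]_n :=
  let c := dot x y in
  let d := acos c in
  (cos (t * d) - c * sin (t * d) / Num.sqrt (1 - c ^+ 2)) *: x
  + (sin (t * d) / Num.sqrt (1 - c ^+ 2)) *: y.

Definition minimal_geodesic_in (R : realType) (n : nat) (S : set 'cV[R]_n)
    (g : R -> 'cV[R]_n) : Prop :=
  exists x y : 'cV[R]_n,
    [/\ unit_sphere R n x, unit_sphere R n y, y <> x /\ y <> - x, g = geodesic x y
      & forall t : R, 0 <= t <= 1 -> S (g t)].

Definition quasiconvex_on (R : realType) (D : set R) (h : R -> R) : Prop :=
  forall s t l : R, D s -> D t -> 0 <= l <= 1 ->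
    h ((1 - l) * s + l * t) <= Num.max (h s) (h t).

Definition spherically_quasiconvex (R : realType) (n : nat)
    (S : set 'cV[R]_n) (f : 'cV[R]_n -> R) : Prop :=
  forall g : R -> 'cV[R]_n, minimal_geodesic_in S g ->
    quasiconvex_on [set t : R | 0 <= t <= 1] (f \o g).

Definition quadf (R : realType) (n : nat) (A : 'M[R]_n) (x : 'cV[R]_n) : R :=
  dot (A *m x) x.

Definition rayleigh (R : realType) (n : nat) (A : 'M[R]_n) (x : 'cV[R]_n) : R :=
  quadf A x / enorm x ^+ 2.

(* Main.v *)
Require Import Defs.
From mathcomp Require Import all_boot all_order all_algebra.
From mathcomp Require Import all_classical all_reals.
From mathcomp Require Import topology normedtype trigo derive convex.
From mathcomp Require Import interval_inference ring lra.
Import Order.TTheory GRing.Theory Num.Theory.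
Import numFieldNormedType.Exports.

Set Implicit Arguments.
Unset Strict Implicit.
Unset Printing Implicit Defensive.

Local Open Scope classical_set_scope.
Local Open Scope ring_scope.

(** All three statements say that one homogeneous function, [defect A], is
    nonnegative on K x K:

      defect A x y = <x,y> max (q x |y|^2) (q y |x|^2) - <Ax,y> |x|^2 |y|^2.

    It is multiplied by (a b)^3 when x and y are scaled by a and b, so its sign
    on a cone is decided on the unit vectors of the cone ([defect_ge0_cone]),
    where it is the inequality of (b) ([defect_sphere]). When <x,y> > 0 it is
    |x|^2 |y|^2 <x,y> times the gap in (c) ([defect_rayleigh]). The pairs with
    <x,y> = 0, about which (c) is silent, and the boundary of K, about which (a)
    is silent, are both reached by continuity: x and y are pushed into the
    interior of K, where subduality forces <x,y> > 0 unless x is zero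
    ([dot_interior_gt0], [defect_ge0_closure]).

    The link with geodesics is that a point of the arc between two points p and
    r of a geodesic is, up to a positive factor, a combination a p + b r with
    a, b >= 0 ([geodesic_slerp]).

    If the defect is nonnegative, put M = max (q p) (q r): the quadratic form
    M |.|^2 - q is nonnegative at p and at r, and its polarization at (p, r) is
    nonnegative too. Hence it is nonnegative on all such combinations, so that q
    is at most M along the arc ([geodesic_quasiconvex]).

    Conversely, let q be quasi-convex along the geodesic from x to y, with
    q x <= q y = M. The form M |.|^2 - q is nonnegative at a x + b y and
    vanishes at y, so a (M - q x) + 2 b (M <x,y> - <Ax,y>) >= 0 after division
    by a > 0. At y, the end of the arc, a tends to 0 while b does not, which
    leaves <Ax,y> <= M <x,y> ([quasiconvex_defect]). *)

(** * The Euclidean inner product and quadratic forms *)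

Lemma dotC (R : realType) (n : nat) (x y : 'cV[R]_n) : dot x y = dot y x.
Proof. by apply: eq_bigr => i _; rewrite mulrC. Qed.

Lemma dotDl (R : realType) (n : nat) (x y z : 'cV[R]_n) :
  dot (x + y) z = dot x z + dot y z.
Proof. by rewrite -big_split; apply: eq_bigr => i _; rewrite mxE mulrDl. Qed.

Lemma dotZl (R : realType) (n : nat) (a : R) (x z : 'cV[R]_n) :
  dot (a *: x) z = a * dot x z.
Proof. by rewrite mulr_sumr; apply: eq_bigr => i _; rewrite mxE mulrA. Qed.

Lemma dot0l (R : realType) (n : nat) (x : 'cV[R]_n) : dot 0 x = 0.
Proof. by rewrite -(scale0r (0 : 'cV[R]_n)) dotZl mul0r. Qed.

Lemma dotDr (R : realType) (n : nat) (x y z : 'cV[R]_n) :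
  dot z (x + y) = dot z x + dot z y.
Proof. by rewrite dotC dotDl !(dotC z). Qed.

Lemma dotZr (R : realType) (n : nat) (a : R) (x z : 'cV[R]_n) :
  dot z (a *: x) = a * dot z x.
Proof. by rewrite dotC dotZl dotC. Qed.

Lemma dot_mulmxl (R : realType) (n : nat) (A : 'M[R]_n) (x y : 'cV[R]_n) :
  dot (A *m x) y = dot x (A^T *m y).
Proof.
have dotE (u v : 'cV[R]_n) : dot u v = (u^T *m v) 0 0.
  by rewrite mxE; apply: eq_bigr => i _; rewrite mxE.
by rewrite !dotE trmx_mul mulmxA.
Qed.

Lemma dot_ge0 (R : realType) (n : nat) (x : 'cV[R]_n) : 0 <= dot x x.
Proof. by apply: sumr_ge0 => i _; rewrite -expr2 sqr_ge0. Qed.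

Lemma dot_gt0 (R : realType) (n : nat) (x : 'cV[R]_n) : x != 0 -> 0 < dot x x.
Proof.
rewrite lt0r dot_ge0 andbT; apply: contraNneq => /eqP.
rewrite psumr_eq0 => [/allP x0|i _]; last by rewrite -expr2 sqr_ge0.
apply/eqP/colP => i; have := x0 i (mem_index_enum _).
by rewrite mulf_eq0 orbb mxE => /eqP.
Qed.

Lemma unit_sphereE (R : realType) (n : nat) (x : 'cV[R]_n) :
  unit_sphere R n x <-> dot x x = 1.
Proof.
split=> [/= e1|x1]; last by rewrite /unit_sphere /= /enorm x1 sqrtr1.
by rewrite -(sqr_sqrtr (dot_ge0 x)) -/(enorm x) e1 expr1n.
Qed.

Lemma unit_sphere_normalize (R : realType) (n : nat) (x : 'cV[R]_n) :
  x != 0 -> unit_sphere R n ((enorm x)^-1 *: x).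
Proof.
move=> /dot_gt0 x0; apply/unit_sphereE; rewrite dotZl dotZr mulrA -invfM.
by rewrite -expr2 sqr_sqrtr ?dot_ge0 // mulVf // gt_eqF.
Qed.

Lemma rayleighE (R : realType) (n : nat) (A : 'M[R]_n) (x : 'cV[R]_n) :
  rayleigh A x = quadf A x / dot x x.
Proof. by rewrite /rayleigh sqr_sqrtr ?dot_ge0. Qed.

Lemma quadf_comb (R : realType) (n : nat) (A : 'M[R]_n) (a b : R)
    (x y : 'cV[R]_n) : A^T = A ->
  quadf A (a *: x + b *: y) =
    a ^+ 2 * quadf A x + b ^+ 2 * quadf A y + 2 * (a * b) * dot (A *m x) y.
Proof.
move=> As; have yx : dot (A *m y) x = dot (A *m x) y.
  by rewrite dot_mulmxl As dotC.
rewrite /quadf mulmxDr -!scalemxAr !(dotDl, dotDr, dotZl, dotZr) yx; ring.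
Qed.

Lemma dot_comb (R : realType) (n : nat) (a b : R) (x y : 'cV[R]_n) :
  dot (a *: x + b *: y) (a *: x + b *: y) =
    a ^+ 2 * dot x x + b ^+ 2 * dot y y + 2 * (a * b) * dot x y.
Proof. rewrite !(dotDl, dotDr, dotZl, dotZr) (dotC y x); ring. Qed.

(** * The homogeneous gap *)

(** Clearing the denominators |x|^2 and |y|^2 makes this continuous
    everywhere, zero vectors included, so that inequalities pass to the boundary
    of a cone. *)
Definition defect (R : realType) (n : nat) (A : 'M[R]_n) (x y : 'cV[R]_n) : R :=
  dot x y * Num.max (quadf A x * dot y y) (quadf A y * dot x x)
  - dot (A *m x) y * (dot x x * dot y y).

Lemma defect_sphere (R : realType) (n : nat) (A : 'M[R]_n) (x y : 'cV[R]_n) :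
  unit_sphere R n x -> unit_sphere R n y ->
  (0 <= defect A x y) =
  (dot (A *m x) y <= dot x y * Num.max (quadf A x) (quadf A y)).
Proof.
move=> /unit_sphereE x1 /unit_sphereE y1.
by rewrite /defect x1 y1 !mulr1 subr_ge0.
Qed.


Lemma defect_rayleigh (R : realType) (n : nat) (A : 'M[R]_n)
    (x y : 'cV[R]_n) : 0 < dot x y ->
  (0 <= defect A x y) =
  (dot (A *m x) y / dot x y <= Num.max (rayleigh A x) (rayleigh A y)).
Proof.
move=> xy; have x0 : 0 < dot x x.
  by apply: dot_gt0; apply: contraTneq xy => ->; rewrite dot0l ltxx.
have y0 : 0 < dot y y.
  by apply: dot_gt0; apply: contraTneq xy => ->; rewrite dotC dot0l ltxx.
have -> : defect A x y = (dot x x * dot y y) *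
    (dot x y * Num.max (rayleigh A x) (rayleigh A y) - dot (A *m x) y).
  rewrite mulrBr mulrCA maxr_pMr ?mulr_ge0 ?ltW // !rayleighE.
  rewrite (mulrC (_ * _) (dot (A *m x) y)) /defect.
  by congr (_ * Num.max _ _ - _); field; rewrite gt_eqF.
by rewrite pmulr_rge0 ?mulr_gt0 // subr_ge0 ler_pdivrMr // [_ * dot x y]mulrC.
Qed.

Lemma quadfZ (R : realType) (n : nat) (A : 'M[R]_n) (a : R) (x : 'cV[R]_n) :
  quadf A (a *: x) = a ^+ 2 * quadf A x.
Proof. by rewrite /quadf -scalemxAr dotZl dotZr mulrA. Qed.

Lemma defectZ (R : realType) (n : nat) (A : 'M[R]_n) (a b : R)
    (x y : 'cV[R]_n) :
  defect A (a *: x) (b *: y) = (a * b) ^+ 3 * defect A x y.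
Proof.
rewrite /defect !quadfZ -scalemxAr !(dotZl, dotZr).
have -> : a ^+ 2 * quadf A x * (b * (b * dot y y)) =
    (a * b) ^+ 2 * (quadf A x * dot y y) by ring.
have -> : b ^+ 2 * quadf A y * (a * (a * dot x x)) =
    (a * b) ^+ 2 * (quadf A y * dot x x) by ring.
by rewrite -maxr_pMr ?sqr_ge0 //; ring.
Qed.

Lemma defect0l (R : realType) (n : nat) (A : 'M[R]_n) (y : 'cV[R]_n) :
  defect A 0 y = 0.
Proof. by rewrite /defect mulmx0 !dot0l !mul0r subr0. Qed.

Lemma defect0r (R : realType) (n : nat) (A : 'M[R]_n) (x : 'cV[R]_n) :
  defect A x 0 = 0.
Proof. by rewrite /defect !(dotC _ 0) !dot0l !mul0r subr0. Qed.

Lemma enorm_gt0 (R : realType) (n : nat) (x : 'cV[R]_n) :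
  x != 0 -> 0 < enorm x.
Proof. by move=> /dot_gt0; rewrite /enorm sqrtr_gt0. Qed.

(** By homogeneity only unit vectors matter; a zero argument makes the defect
    vanish. *)
Lemma defect_ge0_cone (R : realType) (n : nat) (A : 'M[R]_n)
    (C : set 'cV[R]_n) : is_cone C ->
  (forall x y, (unit_sphere R n `&` C) x -> (unit_sphere R n `&` C) y ->
    0 <= defect A x y) ->
  forall x y, C x -> C y -> 0 <= defect A x y.
Proof.
move=> coneC H x y Cx Cy.
have [->|x0] := eqVneq x 0; first by rewrite defect0l.
have [->|y0] := eqVneq y 0; first by rewrite defect0r.
have unitC z : z != 0 -> C z -> (unit_sphere R n `&` C) ((enorm z)^-1 *: z).
  move=> z0 Cz; split; first exact: unit_sphere_normalize.
  by apply: coneC => //; rewrite invr_gt0 enorm_gt0.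
have := H _ _ (unitC _ x0 Cx) (unitC _ y0 Cy).
by rewrite defectZ pmulr_rge0 // exprn_gt0 // mulr_gt0 // invr_gt0 enorm_gt0.
Qed.

(** * The interior of a cone *)

(** The topology on column vectors is that of the sup norm, so a neighborhood
    is a coordinatewise bound. *)
Lemma interior_colP (R : realType) (n : nat) (K : set 'cV[R]_n)
    (x : 'cV[R]_n) :
  interior K x <->
  exists2 e : R, 0 < e & forall v : 'cV[R]_n,
    (forall i, `|v i 0| < e) -> K (x + v).
Proof.
rewrite /interior /= -nbhs_ballE; split=> -[e /= e0 He]; exists e => //.
  move=> v ve; apply: He; split=> // i j; rewrite ord1 mxE /ball /=.
  by rewrite opprD addNKr normrN.
move=> y [_ xy]; rewrite -[y](subrK x) addrC; apply: He => i.
by rewrite !mxE distrC; exact: xy.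
Qed.

Lemma interior_cone (R : realType) (n : nat) (K : set 'cV[R]_n) :
  is_cone K -> is_cone (interior K).
Proof.
move=> coneK x a /interior_colP[e e0 He] a0; apply/interior_colP.
exists (a * e) => [|v ve]; first exact: mulr_gt0.
have -> : a *: x + v = a *: (x + a^-1 *: v).
  by rewrite scalerDr scalerA mulfV ?scale1r ?gt_eqF.
apply: coneK => //; apply: He => i.
by rewrite mxE normrM gtr0_norm ?invr_gt0 // mulrC ltr_pdivrMr // mulrC.
Qed.

(** The sum is twice the midpoint. *)
Lemma cone_addr (R : realType) (n : nat) (K : set 'cV[R]_n) :
  is_cone K -> convex_set (K : set (convex_lmodType 'cV[R]_n)) ->
  forall x y, K x -> K y -> K (x + y).
Proof.
move=> coneK convK x y Kx Ky.
have h0 : 0 <= 2^-1 :> R by lra.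
have h1 : 2^-1 <= 1 :> R by lra.
have /set_mem Kxy : _ := convK x y (Itv01 h0 h1) (mem_set Kx) (mem_set Ky).
have {}Kxy : K (2^-1 *: x + (1 - 2^-1) *: y) by exact: Kxy.
have -> : x + y = 2 *: (2^-1 *: x + (1 - 2^-1) *: y).
  by rewrite scalerDr !scalerA -[LHS]/(x + y) -{1}[x]scale1r -{1}[y]scale1r;
     congr (_ *: _ + _ *: _); field.
exact: coneK.
Qed.

Section ProperCone.
Variables (R : realType) (n : nat) (K : set 'cV[R]_n).
Hypotheses (coneK : is_cone K)
  (convK : convex_set (K : set (convex_lmodType 'cV[R]_n))).

Lemma interior_addr x y : interior K x -> K y -> interior K (x + y).
Proof.
move=> /interior_colP[e e0 He] Ky; apply/interior_colP; exists e => // v ve.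
by rewrite addrAC; apply: cone_addr => //; exact: He.
Qed.

Lemma interior_comb a b x y : 0 <= a -> 0 <= b -> 0 < a + b ->
  interior K x -> interior K y -> interior K (a *: x + b *: y).
Proof.
move=> a0 b0 ab0 Kx Ky; have intK := interior_cone coneK.
have [a1|a_gt0] := leP a 0.
  have -> : a = 0 by lra.
  by rewrite scale0r add0r; apply: intK => //; lra.
have [b1|b_gt0] := leP b 0.
  have -> : b = 0 by lra.
  by rewrite scale0r addr0; apply: intK.
by apply: interior_addr; [exact: intK | apply: interior_subset; exact: intK].
Qed.

(** For small e > 0 the vector y - e x is still in K, hence in the dual cone, so
    <x,y> >= e |x|^2. *)
Lemma dot_interior_gt0 x y : subdual K ->
  interior K x -> interior K y -> x != 0 -> 0 < dot x y.
Proof.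
move=> subK Kx /interior_colP[e e0 He] x0.
(* N bounds every coordinate of x strictly, so (e / N) x is e-small. *)
pose N := 1 + \sum_i `|x i 0|.
have N0 : 0 < N by rewrite ltr_pwDl // sumr_ge0.
have Kyx : K (y + (- (e / N)) *: x).
  apply: He => i; rewrite mxE normrM normrN (gtr0_norm (divr_gt0 e0 N0)).
  rewrite mulrAC ltr_pdivrMr // ltr_pM2l // /N (bigD1 i) //= addrCA.
  by rewrite ltrDl ltr_pwDl // sumr_ge0.
have := subK _ (interior_subset Kx) _ Kyx.
rewrite dotC dotDr dotZr mulNr subr_ge0; apply: lt_le_trans.
by rewrite mulr_gt0 ?divr_gt0 ?dot_gt0.
Qed.

End ProperCone.

(** * Passing to the boundary *)

Lemma ge0_right_limit (R : realType) (f : R -> R) :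
  {for 0, continuous f} -> (forall s, 0 < s < 1 -> 0 <= f s) -> 0 <= f 0.
Proof.
move=> f0 f_ge0; apply: (@cvgr_to_ge _ (0^'+) _ _ f).
  exact: cvg_at_right_filter.
near=> s; apply: f_ge0; apply/andP; split => //.
Unshelve. all: by end_near. Qed.

Lemma dot_line_continuous (R : realType) (n : nat) (A : 'M[R]_n)
    (x y z w : 'cV[R]_n) :
  continuous (fun s : R => dot (A *m (x + s *: z)) (y + s *: w)).
Proof.
have -> : (fun s : R => dot (A *m (x + s *: z)) (y + s *: w)) =
    (fun s => (Poly [:: dot (A *m x) y; dot (A *m x) w + dot (A *m z) y;
      dot (A *m z) w]).[s]).
  apply/funext => s; rewrite horner_Poly /= mulmxDr -scalemxAr.
  rewrite !(dotDl, dotDr, dotZl, dotZr); ring.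
exact: continuous_horner.
Qed.

Lemma defect_line_continuous (R : realType) (n : nat) (A : 'M[R]_n)
    (x y z : 'cV[R]_n) :
  continuous (fun s : R => defect A (x + s *: z) (y + s *: z)).
Proof.
have cdot (u v w : 'cV[R]_n) :
    continuous (fun s : R => dot (u + s *: w) (v + s *: w)).
  have := @dot_line_continuous R n 1%:M u v w w.
  by under eq_fun do rewrite mul1mx.
move=> s; apply: cvgB; apply: cvgM; try exact: cdot.
- apply: (@continuous_max R R
      (fun s => quadf A (x + s *: z) * dot (y + s *: z) (y + s *: z))
      (fun s => quadf A (y + s *: z) * dot (x + s *: z) (x + s *: z)));
    by apply: cvgM; [exact: dot_line_continuous | exact: cdot].
- exact: dot_line_continuous.
- by apply: cvgM; exact: cdot.
Qed.

(** Every vector x of K is the limit of the interior points x + s z, for z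
    interior and s decreasing to 0. *)
Lemma defect_ge0_closure (R : realType) (n : nat) (K : set 'cV[R]_n)
    (A : 'M[R]_n) : proper_cone K ->
  (forall x y, interior K x -> interior K y -> 0 <= defect A x y) ->
  forall x y, K x -> K y -> 0 <= defect A x y.
Proof.
move=> [coneK convK _ _ [z Kz]] H x y Kx Ky.
have := @ge0_right_limit _ _ (@defect_line_continuous _ _ A x y z 0).
rewrite /= scale0r !addr0; apply=> s /andP[s0 _].
have Ksz : interior K (s *: z) by exact: interior_cone.
by apply: H; rewrite addrC; exact: interior_addr.
Qed.

(** * Geodesics of the sphere *)

(** The form M |.|^2 - q_A has nonnegative coefficients in its expansion on
    a p + b r. *)
Lemma quadf_le_comb (R : realType) (n : nat) (A : 'M[R]_n) (M a b : R)
    (p r : 'cV[R]_n) : A^T = A -> 0 <= a -> 0 <= b ->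
  quadf A p <= M * dot p p -> quadf A r <= M * dot r r ->
  dot (A *m p) r <= M * dot p r ->
  quadf A (a *: p + b *: r) <=
    M * dot (a *: p + b *: r) (a *: p + b *: r).
Proof.
move=> As a0 b0 hp hr hpr; rewrite quadf_comb // dot_comb !mulrDr.
rewrite !(mulrCA M); apply: lerD; first apply: lerD.
- by rewrite ler_wpM2l ?sqr_ge0.
- by rewrite ler_wpM2l ?sqr_ge0.
- by rewrite ler_wpM2l ?mulr_ge0.
Qed.

Section Geodesic.
Variables (R : realType) (n : nat) (x y : 'cV[R]_n).
Hypotheses (x1 : unit_sphere R n x) (y1 : unit_sphere R n y).
Hypotheses (yx : y <> x) (yNx : y <> - x).

Let c := dot x y.
Let d := acos c.
Let g := geodesic x y.

Lemma dot_sphere_bounds : -1 < c < 1.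
Proof.
move/unit_sphereE: x1 => xx; move/unit_sphereE: y1 => yy.
have sub0 : 0 < dot (1 *: y + (-1) *: x) (1 *: y + (-1) *: x).
  by apply: dot_gt0; rewrite scale1r scaleN1r subr_eq0; apply/eqP.
have add0 : 0 < dot (1 *: y + 1 *: x) (1 *: y + 1 *: x).
  by apply: dot_gt0; rewrite !scale1r addr_eq0; apply/eqP.
move: sub0 add0; rewrite !dot_comb xx yy (dotC y x) -/c => sub0 add0.
by apply/andP; split; lra.
Qed.

Lemma geodesic_angle :
  [/\ cos d = c, Num.sqrt (1 - c ^+ 2) = sin d, 0 < sin d & 0 < d < pi].
Proof.
have /andP[cl cr] := dot_sphere_bounds.
have cle : -1 <= c <= 1 by rewrite !ltW.
have [/andP[d0 dpi] cosd] : 0 <= d <= pi /\ cos d = c by exact: acos_def.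
have sind : Num.sqrt (1 - c ^+ 2) = sin d by rewrite -sin_acos.
split=> //; first by rewrite -sind sqrtr_gt0; nra.
rewrite !lt_neqAle d0 dpi !andbT; apply/andP; split; apply/eqP => dE.
  by move: cosd; rewrite -dE cos0 => cE; rewrite -cE ltxx in cr.
by move: cosd; rewrite dE cospi => cE; rewrite -cE ltxx in cl.
Qed.

Lemma geodesic_sphere t : unit_sphere R n (g t).
Proof.
have [cosd sind s0 _] := geodesic_angle.
move/unit_sphereE: x1 => xx; move/unit_sphereE: y1 => yy.
apply/unit_sphereE; rewrite /g /geodesic dot_comb xx yy -/c -/d sind.
have s2 : 1 - c ^+ 2 = sin d ^+ 2.
  by rewrite -(cos2Dsin2 d) cosd addrAC subrr add0r.
transitivity (cos (t * d) ^+ 2 +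
    sin (t * d) ^+ 2 * (1 - c ^+ 2) / sin d ^+ 2).
  by field; rewrite gt_eqF.
by rewrite s2 mulfK ?cos2Dsin2 // expf_neq0 // gt_eqF.
Qed.

Lemma geodesic0 : g 0 = x.
Proof.
by rewrite /g /geodesic mul0r sin0 cos0 mulr0 !mul0r subr0 scale1r scale0r addr0.
Qed.

Lemma geodesic1 : g 1 = y.
Proof.
have [cosd sind s0 _] := geodesic_angle.
rewrite /g /geodesic -/c -/d sind mul1r cosd mulfK ?gt_eqF // subrr scale0r.
by rewrite divff ?gt_eqF // scale1r add0r.
Qed.

(** The coordinates of a geodesic in the plane of x and y solve the equation
    f'' = - d^2 f, and for every solution this is the identity expressing f u by
    its values at s and t. *)
Lemma geodesic_slerp s t u :
  sin (t * d - s * d) *: g u =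
  sin (t * d - u * d) *: g s + sin (u * d - s * d) *: g t.
Proof.
have [cosd sind s0 _] := geodesic_angle.
rewrite /g /geodesic -/c -/d sind !scalerDr !scalerA addrACA -!scalerDl !sinB.
by congr (_ *: _ + _ *: _); field; rewrite gt_eqF.
Qed.

Lemma geodesic_endpoints t :
  sin d *: g t = sin ((1 - t) * d) *: x + sin (t * d) *: y.
Proof.
have := geodesic_slerp 0 1 t.
by rewrite geodesic0 geodesic1 mul0r !subr0 mulrBl mul1r.
Qed.

(** Up to a positive factor the point is a combination of x and y with
    nonnegative coefficients, not both zero since it has norm 1. *)
Lemma geodesic_interior (K : set 'cV[R]_n) t : is_cone K ->
  convex_set (K : set (convex_lmodType 'cV[R]_n)) ->
  interior K x -> interior K y -> 0 <= t <= 1 -> interior K (g t).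
Proof.
move=> coneK convK Kx Ky /andP[t0 t1].
have [_ _ s0 /andP[d0 dpi]] := geodesic_angle.
have -> : g t = (sin d)^-1 *: (sin d *: g t).
  by rewrite scalerA mulVf ?scale1r ?gt_eqF.
apply: interior_cone => //; last by rewrite invr_gt0.
have a0 : 0 <= sin ((1 - t) * d) by apply: sin_ge0_pi; nra.
have b0 : 0 <= sin (t * d) by apply: sin_ge0_pi; nra.
rewrite geodesic_endpoints; apply: interior_comb => //.
rewrite lt0r addr_ge0 // andbT paddr_eq0 //; apply/negP => /andP[/eqP aE /eqP bE].
have := geodesic_endpoints t; rewrite aE bE !scale0r addr0 => /eqP.
rewrite scaler_eq0 gt_eqF //= => /eqP gt0.
have /unit_sphereE := geodesic_sphere t.
by rewrite gt0 dot0l => /eqP; rewrite eq_sym oner_eq0.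
Qed.

End Geodesic.

(** * Quasi-convexity and the sign of the defect *)

(** On the arc between g s and g t the form M |.|^2 - q_A, with M the larger of
    the values of q_A at g s and g t, is nonnegative by [quadf_le_comb]; the bound
    on the mixed term is the sign of the defect at (g s, g t). *)
Lemma geodesic_quasiconvex (R : realType) (n : nat) (A : 'M[R]_n)
    (S : set 'cV[R]_n) : A^T = A -> S `<=` unit_sphere R n ->
  (forall p r, S p -> S r -> 0 <= defect A p r) ->
  spherically_quasiconvex S (quadf A).
Proof.
move=> As S1 defS _ [x [y [x1 y1 [yx yNx] -> gS]]].
have [_ _ _ /andP[d0 dpi]] := geodesic_angle x1 y1 yx yNx.
move=> s t l /= s01 t01 l01.
set g := geodesic x y; set d := acos (dot x y) in d0 dpi *.
wlog st : s t l s01 t01 l01 / s <= t.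
  move=> H; have [/H|/ltW ts] := leP s t; first exact.
  rewrite maxC; have -> : (1 - l) * s + l * t = (1 - (1 - l)) * t + (1 - l) * s.
    by ring.
  by apply: H => //; lra.
have [<-|st_neq] := eqVneq s t.
  by rewrite -mulrDl subrK mul1r maxxx.
have {st st_neq} st : s < t by rewrite lt_neqAle st_neq.
set u := (1 - l) * s + l * t.
have s0 : 0 < sin (t * d - s * d) by apply: sin_gt0_pi; nra.
have a0 : 0 <= sin (t * d - u * d).
  have -> : t * d - u * d = (1 - l) * ((t - s) * d) by rewrite /u; ring.
  have tsd : 0 <= (t - s) * d <= pi by nra.
  by apply: sin_ge0_pi; nra.
have b0 : 0 <= sin (u * d - s * d).
  have -> : u * d - s * d = l * ((t - s) * d) by rewrite /u; ring.
  have tsd : 0 <= (t - s) * d <= pi by nra.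
  by apply: sin_ge0_pi; nra.
have unit_dot v : S v -> dot v v = 1 by move/S1/unit_sphereE.
have [Sgs Sgt] : S (g s) /\ S (g t) by split; exact: gS.
set M := Num.max _ _.
have hst : dot (A *m g s) (g t) <= M * dot (g s) (g t).
  by rewrite mulrC -(defect_sphere _ (S1 _ Sgs) (S1 _ Sgt)) defS.
have hs : quadf A (g s) <= M * dot (g s) (g s).
  by rewrite unit_dot // mulr1 le_max lexx.
have ht : quadf A (g t) <= M * dot (g t) (g t).
  by rewrite unit_dot // mulr1 le_max lexx orbT.
have := quadf_le_comb As a0 b0 hs ht hst.
rewrite -(geodesic_slerp x1 y1 yx yNx) quadfZ dotZl dotZr.
have -> : dot (geodesic x y u) (geodesic x y u) = 1.
  by apply/unit_sphereE; exact: geodesic_sphere.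
by rewrite mulr1 -expr2 mulrC ler_pM2r ?exprn_gt0.
Qed.

(** First-order information at the endpoint with the larger value, say y: expand
    q_A at the point of parameter 1 - s and let s decrease to 0. *)
Lemma quasiconvex_defect (R : realType) (n : nat) (K : set 'cV[R]_n)
    (A : 'M[R]_n) : A^T = A -> proper_cone K ->
  spherically_quasiconvex (unit_sphere R n `&` interior K) (quadf A) ->
  forall x y, (unit_sphere R n `&` interior K) x ->
    (unit_sphere R n `&` interior K) y -> 0 <= defect A x y.
Proof.
move=> As [coneK convK _ pointK _] quasi x y [x1 Kx] [y1 Ky].
wlog xy : x y x1 Kx y1 Ky / quadf A x <= quadf A y.
  move=> H; have [/H|/ltW yx] := leP (quadf A x) (quadf A y); first exact.
  have := H y x y1 Ky x1 Kx yx.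
  by rewrite !defect_sphere // maxC (dotC y x) dot_mulmxl As dotC.
rewrite defect_sphere // (max_idPr xy).
have /unit_sphereE xx := x1; have /unit_sphereE yy := y1.
have [<-|/eqP yx] := eqVneq x y; first by rewrite xx mul1r.
have {}yx : y <> x by move/esym.
have yNx : y <> - x.
  move=> yE; move: xx.
  rewrite (pointK x (interior_subset Kx)); last by rewrite -yE; exact: interior_subset.
  by rewrite dot0l => /eqP; rewrite eq_sym oner_eq0.
have [_ _ s0 /andP[d0 dpi]] := geodesic_angle x1 y1 yx yNx.
have gS t : 0 <= t <= 1 ->
    (unit_sphere R n `&` interior K) (geodesic x y t).
  by split; [exact: geodesic_sphere | exact: geodesic_interior].
have quasi_xy := quasi _ (ex_intro _ x (ex_intro _ y
  (And5 x1 y1 (conj yx yNx) erefl gS))).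
set d := acos (dot x y) in s0 d0 dpi *; set M := quadf A y in xy *.
pose E := M * dot x y - dot (A *m x) y.
(* Written as the value at s = 0 of the function whose sign is known for
   0 < s < 1. *)
suff : 0 <= sin (0 * d) * (M - quadf A x) + 2 * sin ((1 - 0) * d) * E.
  rewrite mul0r sin0 mul0r add0r subr0 mul1r pmulr_rge0 ?mulr_gt0 //.
  by rewrite subr_ge0 mulrC.
apply: (@ge0_right_limit _ (fun s => sin (s * d) * (M - quadf A x)
    + 2 * sin ((1 - s) * d) * E)) => [|s /andP[sgt0 s1]].
  have csin (f : R -> R) : {for 0, continuous f} ->
      {for 0, continuous (fun s => sin (f s * d))}.
    move=> cf; apply: (@continuous_comp _ _ _ (fun s => f s * d) sin).
      by apply: cvgM => //; exact: cvg_cst.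
    exact: continuous_sin.
  apply: cvgD; apply: cvgM; try exact: cvg_cst.
    by apply: csin; exact: cvg_id.
  apply: cvgM; first exact: cvg_cst.
  by apply: csin; apply: cvgB; [exact: cvg_cst | exact: cvg_id].
have := quasi_xy 0 1 (1 - s).
rewrite /= geodesic0 geodesic1 // (max_idPr xy) !lexx ler01.
rewrite mulr0 mulr1 add0r => /(_ isT isT).
have -> : 0 <= 1 - s <= 1 by lra.
move=> /(_ isT) hM.
have a0 : 0 < sin (s * d) by apply: sin_gt0_pi; nra.
have gE := geodesic_endpoints x1 y1 yx yNx (1 - s).
have g1 : dot (geodesic x y (1 - s)) (geodesic x y (1 - s)) = 1.
  by apply/unit_sphereE; exact: geodesic_sphere.
have := quadfZ A (sin d) (geodesic x y (1 - s)).
have : dot (sin d *: geodesic x y (1 - s)) (sin d *: geodesic x y (1 - s))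
    = sin d ^+ 2 by rewrite dotZl dotZr g1 mulr1 -expr2.
(* The coefficient sin (s d) of x factors out because M - q_A vanishes at y. *)
rewrite gE subKr dot_comb quadf_comb // xx yy -/M => dE qE.
have : 0 <= sin d ^+ 2 * (M - quadf A (geodesic x y (1 - s))).
  by rewrite mulr_ge0 ?sqr_ge0 // subr_ge0.
rewrite mulrBr -qE -dE => ge0; rewrite -(pmulr_rge0 _ a0) /E.
by move: ge0; congr (0 <= _); ring.
Qed.

Theorem proposition5p2p1 (R : realType) (n : nat) (K : set 'cV[R]_n)
    (A : 'M[R]_n) (hK : proper_cone K) (hsub : subdual K) (hA : A^T = A) :
  let a := spherically_quasiconvex (unit_sphere R n `&` interior K) (quadf A) in
  let b := forall x y : 'cV[R]_n,
    (unit_sphere R n `&` K) x -> (unit_sphere R n `&` K) y ->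
    dot (A *m x) y <= dot x y * Num.max (quadf A x) (quadf A y) in
  let c := forall x y : 'cV[R]_n, K x -> K y -> dot x y != 0 ->
    dot (A *m x) y / dot x y <= Num.max (rayleigh A x) (rayleigh A y) in
  (a <-> b) /\ (b <-> c).
Proof.
move=> a b c; have [coneK convK _ _ _] := hK.
pose D := forall x y, K x -> K y -> 0 <= defect A x y.
have bD : b <-> D.
  split=> [hb|hD x y [x1 Kx] [y1 Ky]].
    apply: defect_ge0_cone => // x y [x1 Kx] [y1 Ky].
    by rewrite defect_sphere //; exact: hb.
  by rewrite -defect_sphere //; exact: hD.
have aD : a <-> D.
  split=> [ha|hD].
    apply: defect_ge0_closure => //.
    apply: defect_ge0_cone; first exact: interior_cone.
    exact: quasiconvex_defect.
  apply: geodesic_quasiconvex => [|x []|p r [_ Kp] [_ Kr]] //.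
  by apply: hD; exact: interior_subset.
have cD : c <-> D.
  split=> [hc|hD x y Kx Ky xy].
    apply: defect_ge0_closure => // x y Kx Ky.
    have [->|x0] := eqVneq x 0; first by rewrite defect0l.
    have xy : 0 < dot x y by exact: dot_interior_gt0 Kx Ky x0.
    by rewrite defect_rayleigh //; apply: hc;
      rewrite ?gt_eqF //; exact: interior_subset.
  rewrite -defect_rayleigh; first exact: hD.
  by rewrite lt0r xy; exact: (hsub _ Ky _ Kx).
by split; [rewrite aD bD | rewrite bD cD].
Qed.
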